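(* There is a polynomial-time algorithm that, given a finite set $\mathcal{C}$ of alternatives, an alternative $c\in\mathcal{C}$ and a profile $P_{poset}$ of partial orders on $\mathcal{C}$, checks whether or not $c$ is a necessary winner for $P_{poset}$ with respect to maximin.
   Context: Let $\mathcal{C}$ be a finite set of $m$ alternatives; $m$ is part of the input and not bounded, and votes are unweighted. A (complete) profile is a finite list $P=(V_1,\dots,V_n)$ of linear orders on $\mathcal{C}$. A voting rule $r$ maps each profile to a nonempty subset of $\mathcal{C}$ (the winners). A partial order is a reflexive, transitive, antisymmetric relation; a linear order $V$ extends a partial order $O$ if $O\subseteq V$. A profile $P=(V_1,\dots,V_n)$ of linear orders extends a profile $P_{poset}=(O_1,\dots,O_n)$ of partial orders if each $V_i$ extends $O_i$. An alternative $c$ is a necessary winner for $P_{poset}$ with respect to $r$ if every extension $P$ of $P_{poset}$ satisfies $r(P)=\{c\}$. Maximin (Simpson): let $N_P(a,b)$ be the number of votes in $P$ that rank $a$ ahead of $b$. The winners are the alternatives $a$ maximizing $\min\{N_P(a,b): b\in\mathcal{C}, b\neq a\}$. *)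

(* Defs.v *)
From mathcomp Require Import all_boot all_order all_algebra.

Set Implicit Arguments.
Unset Strict Implicit.
Unset Printing Implicit Defensive.

Import GRing.Theory.

Section Orders.
Variable C : finType.

Record partial_order := PartialOrder {
  po_rel :> rel C;
  po_refl : reflexive po_rel;
  po_antisym : antisymmetric po_rel;
  po_trans : transitive po_rel }.

Record linear_order := LinearOrder {
  lo_po :> partial_order;
  lo_total : total lo_po }.

(* An order [V] is read as a ranking from top to bottom: [V a b] means that
   [a] is ranked ahead of [b], or that [a = b]. *)
Definition ahead (V : linear_order) (a b : C) : bool := (a != b) && V a b.

Definition extends (V : linear_order) (O : partial_order) : Prop := subrel O V.

Definition profile_extends n (P : n.-tuple linear_order)
    (Ps : n.-tuple partial_order) : Prop :=
  forall i : 'I_n, extends (tnth P i) (tnth Ps i).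

Definition voting_rule := forall n : nat, n.-tuple linear_order -> {set C}.

Definition necessary_winner (r : voting_rule) n (Ps : n.-tuple partial_order)
    (c : C) : Prop :=
  forall P : n.-tuple linear_order, profile_extends P Ps -> r n P = [set c].

Definition num_ahead n (P : n.-tuple linear_order) (a b : C) : nat :=
  count (fun V => ahead V a b) P.

(* Since [num_ahead P a b <= n], the default value [n] of the iterated minimum
   only matters when [a] is the sole alternative. *)
Definition maximin_score n (P : n.-tuple linear_order) (a : C) : nat :=
  \big[minn/n]_(b : C | b != a) num_ahead P a b.

Definition maximin : voting_rule := fun n P =>
  [set a | [forall b, maximin_score P b <= maximin_score P a]].

Lemma maximin_neq0 (c : C) n (P : n.-tuple linear_order) : maximin P != set0.
Proof.
case: (@arg_maxnP _ c xpredT (maximin_score P)) => // a _ maxa.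
by apply/set0Pn; exists a; rewrite inE; apply/forallP => b; apply: maxa.
Qed.

End Orders.

(* Deterministic Turing machines with [tm_tapes.+1] two-way infinite tapes. *)
Variant move := MoveLeft | MoveStay | MoveRight.

Record turing_machine := TuringMachine {
  tm_tapes : nat;
  tm_symbol : finType;
  tm_blank : tm_symbol;
  tm_bit : bool -> tm_symbol;
  tm_bit_inj : injective tm_bit;
  tm_bit_nblank : forall b, tm_bit b != tm_blank;
  tm_state : finType;
  tm_start : tm_state;
  tm_halting : pred tm_state;
  tm_accepting : pred tm_state;
  tm_delta : tm_state -> {ffun 'I_tm_tapes.+1 -> tm_symbol} ->
             tm_state * {ffun 'I_tm_tapes.+1 -> tm_symbol} *
             ('I_tm_tapes.+1 -> move) }.

Section Run.
Variable M : turing_machine.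

Record config := Config {
  cf_state : tm_state M;
  cf_tape : 'I_(tm_tapes M).+1 -> int -> tm_symbol M;
  cf_head : 'I_(tm_tapes M).+1 -> int }.

Definition halted (x : config) : bool := tm_halting (cf_state x).
Definition accepts (x : config) : bool := tm_accepting (cf_state x).

Definition shift (d : move) (p : int) : int :=
  match d with
  | MoveLeft => (p - 1)%R
  | MoveStay => p
  | MoveRight => (p + 1)%R
  end.

(* Halted configurations are fixed points, so that "halts within [t] steps" is
   [halted (iter t step x)]. *)
Definition step (x : config) : config :=
  if halted x then x else
  let: (q, w, d) :=
    tm_delta (cf_state x) [ffun k => cf_tape x k (cf_head x k)] in
  Config q
    (fun k p => if p == cf_head x k then w k else cf_tape x k p)
    (fun k => shift (d k) (cf_head x k)).

(* The input occupies cells 0, ..., size s - 1 of tape 0; all other cells of all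
   tapes are blank, and all heads are at cell 0. *)
Definition init (s : seq bool) : config :=
  Config (tm_start M)
    (fun k p => match p with
                | Posz i => if k == ord0 then nth (tm_blank M) (map (@tm_bit M) s) i
                            else tm_blank M
                | Negz _ => tm_blank M
                end)
    (fun=> 0%R).

End Run.

(* Deterministic polynomial time, measured in the length of the encoded
   instance; nothing is required on strings that encode no instance. *)
Definition polytime_decidable (T : Type) (enc : T -> seq bool) (Q : T -> Prop)
    : Prop :=
  exists (M : turing_machine) (p : {poly nat}), forall x : T,
    let y := iter (p.[size (enc x)])%R (@step M) (init M (enc x)) in
    halted y /\ (accepts y <-> Q x).

Record poset_instance := PosetInstance {
  pi_alt : finType;
  pi_cand : pi_alt;
  pi_size : nat;
  pi_profile : pi_size.-tuple (partial_order pi_alt) }.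

Definition unary (k : nat) : seq bool := rcons (nseq k true) false.

Definition order_bits (C : finType) (O : partial_order C) : seq bool :=
  [seq O a b | a <- enum C, b <- enum C].

(* The alternatives are numbered 0, ..., #|C| - 1 and listed explicitly, hence
   the unary header, followed by one #|C| x #|C| Boolean matrix per vote. *)
Definition encode_instance (I : poset_instance) : seq bool :=
  unary #|pi_alt I| ++ unary (enum_rank (pi_cand I)) ++ unary (pi_size I) ++
  flatten (map (@order_bits (pi_alt I)) (pi_profile I)).

(* Main.v *)
Require Import Defs.
From mathcomp Require Import all_boot all_order all_algebra zify.
From Stdlib Require Import FunctionalExtensionality.

Set Implicit Arguments.
Unset Strict Implicit.
Unset Printing Implicit Defensive.

(** The alternative [c] fails to be a necessary winner iff some [w <> c] can
    reach the score of [c], i.e. iff some extension satisfies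
    [N(c,d) <= N(w,b)] for some [d <> c] and all [b <> w].  For fixed [w] and
    [d] the best extension can be chosen vote by vote: rank [d] ahead of [c]
    whenever the vote allows it, since this lowers [N(c,d)] by one and each
    [N(w,b)] by at most one, and subject to that rank [w] as high as possible.
    So it suffices to compare, for all [w], [d], [b], two counts over the votes,
    each vote contributing a Boolean function of four entries of its matrix.

    The Turing machine is compiled from a small loop language over counters.
    A counter is the head position on a tape whose cells [0] and [N] are marked
    in a first pass over the input, [N] being the input length.  Increments
    saturate at [N], so that every loop runs at most [N] times and the running
    time is bounded by a polynomial read off the syntax of the program. *)

(** * Best extensions of a vote *)

Section KeyOrder.
Variables (C : finType) (key : C -> nat) (key_inj : injective key).

Definition key_rel : rel C := fun a b => key a <= key b.

Lemma key_rel_refl : reflexive key_rel. Proof. by move=> a; apply: leqnn. Qed.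

Lemma key_rel_antisym : antisymmetric key_rel.
Proof. by move=> a b le_ab; apply/key_inj/anti_leq. Qed.

Lemma key_rel_trans : transitive key_rel.
Proof. by move=> b a c; apply: leq_trans. Qed.

Lemma key_rel_total : total key_rel.
Proof. by move=> a b; apply: leq_total. Qed.

Definition key_order : linear_order C :=
  @LinearOrder C (PartialOrder key_rel_refl key_rel_antisym key_rel_trans)
    key_rel_total.

End KeyOrder.

Section LevelOrder.
Variables (C : finType) (O : partial_order C) (f : C -> nat).
Hypothesis f_homo : forall a b, O a b -> f a <= f b.

Let up a := #|[pred x | O x a]|.

Lemma up_leq a : up a <= #|C|. Proof. exact: max_card. Qed.

Lemma up_ltn a b : O a b -> a != b -> up a < up b.
Proof.
move=> Oab neq; apply: proper_card; apply/properP; split.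
  by apply/subsetP => x; rewrite !inE => /po_trans; apply.
exists b; rewrite !inE ?po_refl //; apply: contra neq => Oba.
by apply/eqP/(@po_antisym _ O); rewrite Oab.
Qed.

(* Refines the levels [f] by the number of alternatives above, so that [O] is
   respected within a level, and then by an arbitrary numbering. *)
Definition level_key (a : C) : nat :=
  (f a * #|C|.+1 + up a) * #|C| + enum_rank a.

Lemma level_key_leq a b : O a b -> level_key a <= level_key b.
Proof.
move=> Oab; have [->//|neq] := eqVneq a b.
have := up_ltn Oab neq; have := f_homo Oab.
have := ltn_ord (enum_rank a); rewrite /level_key.
move: (up a) (up b) (f a) (f b) (enum_rank a) (enum_rank b) =>
  ua ub fa fb /= ra rb.
rewrite -/#|C|; move: #|_| ra rb => N ra rb lt_r le_f lt_u; nia.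
Qed.

(** [level_key] is a mixed-radix number: [up] is at most [#|C|] and the numbering stays below
    [#|C|], so the lower digits never outweigh a step of [f]. *)
Lemma level_key_ltn a b : f a < f b -> level_key a < level_key b.
Proof.
have := up_leq a; have := ltn_ord (enum_rank a); rewrite /level_key.
move: (up a) (up b) (f a) (f b) (enum_rank a) (enum_rank b) =>
  ua ub fa fb ra rb.
move: #|_| ra rb => N ra rb lt_r le_f lt_u; nia.
Qed.

Lemma level_key_inj : injective level_key.
Proof.
move=> a b eq_k; apply/enum_rank_inj/val_inj.
have := congr1 (modn^~ #|C|) eq_k.
by rewrite /level_key !modnMDl !modn_small.
Qed.

Definition level_order : linear_order C := key_order level_key_inj.

Lemma level_order_extends : extends level_order O.
Proof. exact: level_key_leq. Qed.

Lemma level_order_ahead a b : f a < f b -> ahead level_order a b.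
Proof.
move=> lt_f; have lt_k := level_key_ltn lt_f.
rewrite /ahead /= /key_rel ltnW // andbT.
by apply: contraTneq lt_k => ->; rewrite ltnn.
Qed.

Lemma level_order_nahead a b : f b < f a -> ahead level_order a b = false.
Proof.
move=> lt_f; have lt_k := level_key_ltn lt_f.
by rewrite /ahead /= /key_rel [_ <= _]leqNgt lt_k andbF.
Qed.

End LevelOrder.

Section Votes.
Variables (C : finType) (c w d : C).
Hypotheses (wc : w != c) (dc : d != c).

Definition must_beat (O : partial_order C) : bool := O c d.

(* Whether [w] can be ahead of [b] in an extension that ranks [w] as high as
   possible among those that rank [d] ahead of [c] if possible. *)
Definition can_beat (O : partial_order C) (b : C) : bool :=
  ~~ O b w && ~~ [&& O c w, ~~ O c d & O b d].

(** If [V] ranks [w] ahead of [b] although [can_beat] fails, then [O c w] and [O b d], so [V]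
    contains the chain [c], [w], [b], [d]. The unit gained by [w] over [b] is thus paid for by a
    unit of [c] over [d] that was not forced. *)
Lemma ahead_bound (O : partial_order C) (V : linear_order C) b :
    extends V O -> b != w ->
  must_beat O + ahead V w b <= can_beat O b + ahead V c d.
Proof.
move=> VO neq; rewrite /must_beat /can_beat.
have cd : c != d by rewrite eq_sym.
have wb_bO : ahead V w b -> O b w = false.
  move=> /andP[_ Vwb]; apply: contra_neqF neq => /VO Vbw.
  by apply: (@po_antisym _ V); rewrite Vbw.
have [Ocd|nOcd] := boolP (O c d).
  have -> : ahead V c d by rewrite /ahead cd VO.
  rewrite !andbF /= andbT.
  by case: (boolP (ahead V w b)) => [/wb_bO ->|_] //; rewrite addn0 leq_addl.
case: (boolP (ahead V w b)) => // Hwb; rewrite (wb_bO Hwb) /=.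
case: (boolP (O c w && O b d)) => [/andP[/VO Vcw /VO Vbd]|] //=.
rewrite /ahead cd /=; have -> // : V c d.
have /andP[_ Vwb] := Hwb.
exact: po_trans (po_trans Vcw Vwb) Vbd.
Qed.

(** Blocks from top to bottom. If [c] is forced above [w] but not above [d], everything weakly above
    [d] comes first, then what else is above [w], so that [c] lands between [d] and [w]. Otherwise
    [w] can go as high as [O] permits, followed by what else is above [d]; unless [c] is forced
    above [d], it falls into the last block. *)
Definition level (O : partial_order C) (a : C) : nat :=
  if O c w && ~~ O c d then
    (if O a d then 0 else if a == w then 2 else if O a w then 1 else 3)
  else
    (if a == w then 1 else if O a w then 0 else if O a d then 2 else 3).

(** For each [i] the alternatives of level at most [i] form an up-set: a union of the up-sets of [d]
    and [w], the latter possibly without [w] itself. *)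
Lemma level_homo (O : partial_order C) a b : O a b -> level O a <= level O b.
Proof.
move=> Oab; rewrite /level.
have tr x : O b x -> O a x by apply: po_trans.
(* Removing [w] from its up-set leaves an up-set, by antisymmetry. *)
have ltw : O b w -> b != w -> a != w.
  move=> Obw; apply: contra => /eqP eq_a.
  by apply/eqP/(@po_antisym _ O); rewrite Obw -eq_a.
case: ifP => _; first case: (boolP (O b d)) => [/tr -> //|_].
  case: (O a d) => //; case: eqVneq ltw => [bw _|nbw ltw].
    by case: eqP => // _; rewrite -bw Oab.
  case: (boolP (O b w)) => [Obw|_]; first by rewrite (negPf (ltw Obw _)) // tr.
  by do 2?case: ifP.
case: eqVneq ltw => [bw _|nbw ltw]; first by case: eqP => // _; rewrite -bw Oab.
case: (boolP (O b w)) => [Obw|_]; first by rewrite (negPf (ltw Obw _)) // tr.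
case: (boolP (O b d)) => [/tr -> //|_]; by do 3?case: ifP.
Qed.

(** The order depends on [w] and [d] but not on [b], so a single extension is optimal against all
    opponents of [w] at once. *)
Lemma level_order_attains (O : partial_order C) :
  let V := level_order O (level O) in
  ahead V c d = must_beat O /\ forall b, b != w -> ahead V w b = can_beat O b.
Proof.
move=> V; have cd : c != d by rewrite eq_sym.
have cw : (c == w) = false by rewrite eq_sym (negPf wc).
split=> [|b bw].
  rewrite /must_beat; have [Ocd|nOcd] := boolP (O c d).
    by rewrite /ahead cd; exact: (level_order_extends (@level_homo O) Ocd).
  apply: level_order_nahead; rewrite /level nOcd andbT (negPf nOcd).
  have [Ocw|nOcw] := boolP (O c w).
    by rewrite po_refl cw.
  rewrite cw; case: eqP => // dw; case: (O d w) => //.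
  by rewrite po_refl.
have wV : can_beat O b -> level O w < level O b.
  rewrite /can_beat /level eqxx (negPf bw) => /andP[nObw].
  rewrite (negPf nObw) andbA; case: ifP => _; last by case: ifP.
  by rewrite /= => /negPf ->; case: ifP.
have nwV : ~~ can_beat O b -> ahead V w b = false.
  rewrite /can_beat negb_and !negbK => /orP[Obw|/and3P[Ocw nOcd Obd]].
    rewrite /ahead; case: eqVneq bw => //= neq _.
    have Vbw := level_order_extends (level_homo (O := O)) Obw.
    by apply: contra_neqF neq => Vwb; apply: (@po_antisym _ V); apply/andP.
  (* Here [b] is in the top block, above [d]; [w] is not, as [O w d] would give [O c d]. *)
  apply: level_order_nahead; rewrite /level Ocw nOcd Obd eqxx /=.
  case: ifP => // Owd; case/negP: nOcd; exact: po_trans Ocw Owd.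
by case: (boolP (can_beat O b)) => [/wV/level_order_ahead ->|/nwV].
Qed.

End Votes.

(** * Necessary winners as absence of ties *)

Lemma count_tuple (T : Type) n (a : pred T) (t : n.-tuple T) :
  count a t = \sum_(i < n) a (tnth t i).
Proof. by rewrite -sum1_count big_tuple big_mkcond. Qed.

Section NecessaryWinner.
Variables (C : finType) (n : nat) (Ps : n.-tuple (partial_order C)) (c : C).

(** The two counts are [N(c,d)] and [N(w,b)] in the profile of optimal extensions; [d] witnesses
    that the score of [c] is low. *)
Definition can_tie (w d : C) : Prop :=
  [/\ w != c, d != c & forall b, b != w ->
    count (must_beat c d) Ps <= count (fun O => can_beat c w d O b) Ps].

Lemma maximin_score_leq (P : n.-tuple (linear_order C)) a b :
  b != a -> maximin_score P a <= num_ahead P a b.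
Proof.
rewrite /maximin_score => ba; have := mem_index_enum b.
elim: (index_enum C) => // x r IHr.
rewrite inE big_cons => /predU1P[<-|/IHr le_r].
  by rewrite ba geq_minl.
by case: ifP => // _; rewrite geq_min le_r orbT.
Qed.

(** The assumption [v <= n] takes care of the default value of the minimum. *)
Lemma maximin_score_geq (P : n.-tuple (linear_order C)) a v :
    v <= n -> (forall b, b != a -> v <= num_ahead P a b) ->
  v <= maximin_score P a.
Proof.
move=> le_v le_a; rewrite /maximin_score.
by elim/big_ind: _ => // x y le_x le_y; rewrite leq_min le_x.
Qed.

(** The alternative [w] makes the range of the minimum nonempty. *)
Lemma maximin_score_attained (P : n.-tuple (linear_order C)) a w : w != a ->
  exists2 d, d != a & num_ahead P a d = maximin_score P a.
Proof.
move=> wa; case: (@arg_minnP _ w [pred b | b != a] (num_ahead P a) wa).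
move=> d /= da min_d; exists d => //; apply/eqP; rewrite eqn_leq.
rewrite maximin_score_leq // andbT; apply: maximin_score_geq => //.
by rewrite (leq_trans (count_size _ _)) // size_tuple.
Qed.

(** A tie makes [w] score at least as much as [c] in the profile of optimal extensions, so [c] is
    not the unique winner there. Conversely, if [w] reaches the score of [c] in some extension, any
    [d] attaining that score gives a tie. *)
Lemma necessary_winnerP :
  necessary_winner (@maximin C) Ps c <-> ~ exists w d, can_tie w d.
Proof.
split=> [nec [w [d [wc dc tie]]]|notie P ext].
  pose V O := level_order O (level c w d O).
  pose P := [tuple of map V Ps].
  have ext : profile_extends P Ps.
    by move=> i; rewrite tnth_map; apply/level_order_extends/level_homo.
  have att O := level_order_attains wc dc O.
  have cdE : num_ahead P c d = count (must_beat c d) Ps.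
    rewrite /num_ahead count_map; apply: eq_count => O /=.
    by rewrite (att O).1.
  have wbE b : b != w ->
      num_ahead P w b = count (fun O => can_beat c w d O b) Ps.
    move=> bw; rewrite /num_ahead count_map; apply: eq_count => O /=.
    by rewrite (att O).2.
  have le_cw : maximin_score P c <= maximin_score P w.
    apply: leq_trans (maximin_score_leq P dc) _; apply: maximin_score_geq.
      by rewrite (leq_trans (count_size _ _)) // size_tuple.
    by move=> b bw; rewrite cdE wbE ?tie.
  have : c \in maximin P by rewrite (nec P ext) inE.
  rewrite inE => /forallP max_c.
  have : w \in maximin P.
    by rewrite inE; apply/forallP => b; apply: leq_trans (max_c b) le_cw.
  by rewrite (nec P ext) inE (negPf wc).
have lt_wc w : w != c -> maximin_score P w < maximin_score P c.
  move=> wc; rewrite ltnNge; apply/negP => le_cw.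
  have [d dc dE] := maximin_score_attained P wc.
  apply: notie; exists w, d; split=> // b bw.
  have le_dw : num_ahead P c d <= num_ahead P w b.
    by rewrite dE (leq_trans le_cw) // maximin_score_leq.
  (* With [N(w,b)] added on both sides, the claim follows from [ahead_bound] summed over the votes
     together with [N(c,d) <= N(w,b)]. *)
  rewrite -(leq_add2r (num_ahead P w b)).
  apply: (@leq_trans
    (count (fun O => can_beat c w d O b) Ps + num_ahead P c d));
    last by rewrite leq_add2l.
  rewrite /num_ahead !count_tuple -!big_split /=.
  by apply: leq_sum => i _; apply: ahead_bound.
apply/setP => a; rewrite !inE; apply/forallP/eqP => [max_a|-> b].
  apply/eqP; apply: contraT => ac.
  by have := max_a c; rewrite leqNgt lt_wc.
by have [->//|/lt_wc/ltnW] := eqVneq b c.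
Qed.

End NecessaryWinner.

(** * Control graphs of Turing machines *)

Section Graphs.
Variable k : nat.

Notation tape := 'I_(k.+1 + k.+1).
(** The components are the mark of cell [0], the mark of cell [N], and the input bit, if any. *)
Definition symbol : finType := (bool * bool * option bool)%type.
Definition view := {ffun tape -> symbol}.
Definition moves := tape -> move.

(** The successor [None] is the exit, which composite graphs redirect; the exiting transition still
    acts on the tapes and counts as a step. *)
Record graph := Graph {
  gst : finType;
  gentry : gst;
  gnext : gst -> view -> view * moves * option gst }.

Record store := Store {
  cells : tape -> int -> symbol;
  heads : tape -> int }.

Definition look (x : store) : view := [ffun j => cells x j (heads x j)].

Definition perform (a : view * moves) (x : store) : store :=
  Store (fun j p => if p == heads x j then a.1 j else cells x j p)
        (fun j => shift (a.2 j) (heads x j)).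

Inductive exec (G : graph) : gst G -> store -> nat -> store -> Prop :=
| ExecStop s x a : gnext s (look x) = (a, None) -> exec s x 1 (perform a x)
| ExecStep s x a s' t y : gnext s (look x) = (a, Some s') ->
    exec s' (perform a x) t y -> exec s x t.+1 y.

Definition runs (G : graph) (b : nat) (x y : store) : Prop :=
  exists2 t, t <= b & exec (gentry G) x t y.

Lemma runs_leq (G : graph) b b' x y : b <= b' -> runs G b x y -> runs G b' x y.
Proof. by move=> le_b [t le_t ex]; exists t; rewrite // (leq_trans le_t). Qed.

Definition gprim (f : view -> view * moves * bool) : graph :=
  @Graph unit tt (fun _ v => let: (a, again) := f v in
                             (a, if again then Some tt else None)).

Definition gseq (G1 G2 : graph) : graph :=
  @Graph (gst G1 + gst G2)%type (inl (gentry G1)) (fun q v =>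
    match q with
    | inl s => let: (a, o) := gnext s v in
               (a, Some (if o is Some s' then inl s' else inr (gentry G2)))
    | inr s => let: (a, o) := gnext s v in (a, omap inr o)
    end).

Definition gif (test : view -> bool) (G1 G2 : graph) : graph :=
  @Graph (option (gst G1 + gst G2))%type None (fun q v =>
    match q with
    | None => (v, fun=> MoveStay,
               Some (Some (if test v then inl (gentry G1)
                           else inr (gentry G2))))
    | Some (inl s) => let: (a, o) := gnext s v in (a, omap (Some \o inl) o)
    | Some (inr s) => let: (a, o) := gnext s v in (a, omap (Some \o inr) o)
    end).

Definition grep (f : view -> view * moves * bool) (G : graph) : graph :=
  @Graph (option (gst G)) None (fun q v =>
    match q with
    | None => let: (a, again) := f v in
              (a, if again then Some (Some (gentry G)) else None)
    | Some s => let: (a, o) := gnext s v in (a, Some o)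
    end).

Lemma runs_prim f (xs : nat -> store) n a :
    (forall i, i < n -> exists2 b, f (look (xs i)) = (b, true) &
                                   perform b (xs i) = xs i.+1) ->
    f (look (xs n)) = (a, false) ->
  runs (gprim f) n.+1 (xs 0) (perform a (xs n)).
Proof.
move=> again stop; exists n.+1 => //.
elim: n xs again stop => [|n IHn] xs again stop.
  by apply: ExecStop; rewrite /= stop.
have [b fb nextx] := again 0 isT.
apply: (@ExecStep (gprim f) _ _ b tt); first by rewrite /= fb.
by rewrite nextx; apply: (IHn (xs \o succn)) => // i lt_in; apply: again.
Qed.

(** For a subgraph whose exits are exits of the whole graph. *)
Lemma exec_lift (G G' : graph) (emb : gst G -> gst G') s x t y :
    (forall q v, gnext (emb q) v =
       ((gnext q v).1, omap emb (gnext q v).2)) ->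
  exec s x t y -> exec (emb s) x t y.
Proof.
move=> embP; elim=> {s x t y} [q x a e|q x a q' t y e _ IH].
  by apply: ExecStop; rewrite embP e.
by apply: ExecStep IH; rewrite embP e.
Qed.

(** For a subgraph whose exits are redirected to the node [s']. *)
Lemma exec_lift_cat (G G' : graph) (emb : gst G -> gst G') s' s x t y t' z :
    (forall q v, gnext (emb q) v =
       ((gnext q v).1, Some (oapp emb s' (gnext q v).2))) ->
  exec s x t y -> exec s' y t' z -> exec (emb s) x (t + t') z.
Proof.
move=> embP; elim=> {s x t y} [q x a e|q x a q' t y e _ IH] /= ex'.
  by apply: ExecStep ex'; rewrite embP e.
by rewrite addSn; apply: ExecStep (IH ex'); rewrite embP e.
Qed.

Lemma runs_seq G1 G2 b1 b2 x y z :
  runs G1 b1 x y -> runs G2 b2 y z -> runs (gseq G1 G2) (b1 + b2) x z.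
Proof.
move=> [t1 le1 ex1] [t2 le2 ex2]; exists (t1 + t2); first exact: leq_add.
apply: (@exec_lift_cat _ (gseq G1 G2) inl (inr (gentry G2))) ex1 _.
  by move=> q v /=; case: gnext => a [].
by apply: (@exec_lift _ (gseq G1 G2) inr) ex2 => q v /=; case: gnext.
Qed.

Lemma runs_if (test : view -> bool) G1 G2 b1 b2 x y :
  (if test (look x) then runs G1 b1 (perform (look x, fun=> MoveStay) x) y
   else runs G2 b2 (perform (look x, fun=> MoveStay) x) y) ->
  runs (gif test G1 G2) (1 + b1 + b2) x y.
Proof.
case: ifPn => [tst|/negPf tst] [t le_t ex]; exists t.+1; try lia.
  apply: ExecStep; first by rewrite /= tst.
  by apply: (@exec_lift _ (gif test G1 G2) (Some \o inl)) ex => q v /=;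
    case: gnext.
apply: ExecStep; first by rewrite /= tst.
by apply: (@exec_lift _ (gif test G1 G2) (Some \o inr)) ex => q v /=;
  case: gnext.
Qed.

(** Each round costs one step at the loop head and at most [b] in the body; the exit from the head
    adds the last step. *)
Lemma runs_rep f G b (xs : nat -> store) n a :
    (forall i, i < n -> exists2 c, f (look (xs i)) = (c, true) &
                                   runs G b (perform c (xs i)) (xs i.+1)) ->
    f (look (xs n)) = (a, false) ->
  runs (grep f G) (n * b.+1).+1 (xs 0) (perform a (xs n)).
Proof.
elim: n xs => [|n IHn] xs again stop.
  by exists 1 => //; apply: ExecStop; rewrite /= stop.
have [c fc [t le_t ex]] := again 0 isT.
have [i lt_in|t' le_t' ex'] := IHn (xs \o succn) _ stop; first exact: again.
exists (t + t').+1; first by rewrite mulSn; lia.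
apply: ExecStep; first by rewrite /= fc.
apply: (@exec_lift_cat _ (grep f G) Some None) ex ex'.
by move=> q v /=; case: gnext => d [].
Qed.

(** After the graph has exited, in state [inl None], one more step turns the zero mark under the
    head of tape [flag] into the verdict. *)
Definition graph_delta (G : graph) (flag : tape)
    (q : (option (gst G) + bool)%type) (v : view) :=
  match q with
  | inl (Some s) => let: (w, d, o) := gnext s v in (inl o, w, d)
  | inl None => (inr (v flag).1.1, v, fun=> MoveStay)
  | inr b => (inr b, v, fun=> MoveStay)
  end : (option (gst G) + bool)%type * view * moves.

Definition symbol_bit (b : bool) : symbol := (false, false, Some b).

Lemma symbol_bit_inj : injective symbol_bit.
Proof. by move=> b b' []. Qed.

Lemma symbol_bit_nblank b : symbol_bit b != (false, false, None).
Proof. by []. Qed.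

Definition machine (G : graph) (flag : tape) : turing_machine :=
  @TuringMachine (k + k.+1) symbol (false, false, None) symbol_bit
    symbol_bit_inj symbol_bit_nblank (option (gst G) + bool)%type
    (inl (Some (gentry G))) (fun q => if q is inr _ then true else false)
    (fun q => if q is inr b then b else false) (@graph_delta G flag).

Lemma machine_exec G flag s x t y : exec s x t y ->
  iter t (@step (machine G flag))
    (@Config (machine G flag) (inl (Some s)) (cells x) (heads x)) =
  @Config (machine G flag) (inl None) (cells y) (heads y).
Proof.
have next q z a o : gnext q (look z) = (a, o) ->
    @step (machine G flag)
      (@Config (machine G flag) (inl (Some q)) (cells z) (heads z)) =
    @Config (machine G flag) (inl o)
      (cells (perform a z)) (heads (perform a z)).
  by rewrite /step /= -/(look z) => ->; case: a.
elim=> {s x t y} [q z a /next //|q z a q' t y /next e _ IH].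
by rewrite iterSr e.
Qed.

End Graphs.

(** * A loop language on saturating counters *)

Section Commands.
Variable k : nat.

Notation reg := 'I_k.+1.
Notation tape := 'I_(k.+1 + k.+1).
Definition memory := reg -> nat.

Definition upd (m : memory) (r : reg) (v : nat) : memory :=
  fun r' => if r' == r then v else m r'.

Lemma upd_eq m r v : upd m r v r = v.
Proof. by rewrite /upd eqxx. Qed.

Lemma upd_neq m r v r' : r' != r -> upd m r v r' = m r'.
Proof. by rewrite /upd => /negPf ->. Qed.

Lemma upd_id m r : upd m r (m r) = m.
Proof.
by apply: functional_extensionality => r'; rewrite /upd; case: eqP => // ->.
Qed.

Lemma upd_upd m r v v' : upd (upd m r v) r v' = upd m r v'.
Proof.
by apply: functional_extensionality => r'; rewrite /upd; case: eqP.
Qed.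

Lemma updC m r r' v v' : r != r' ->
  upd (upd m r v) r' v' = upd (upd m r' v') r v.
Proof.
move=> neq; apply: functional_extensionality => r''; rewrite /upd.
by case: (eqVneq r'' r) => // ->; rewrite (negPf neq).
Qed.

(** Register [ord0] is the position of the input head, and [Bit] tests the cell there. *)
Inductive test := Bit | Zero of reg.

(** [Scan] reads unary numbers: it passes the block of ones at the input head, stops behind it, and
    adds its length to a register. *)
Inductive cmd :=
| Skip
| Inc of reg
| Dec of reg
| Clear of reg
| Scan of reg
| Seq of cmd & cmd
| If of test & cmd & cmd
| For of reg & cmd.

Definition test_vars (t : test) : seq reg :=
  if t is Zero r then [:: r] else [:: ord0].

Fixpoint vars (c : cmd) : seq reg :=
  match c with
  | Skip => [::]
  | Inc r | Dec r | Clear r => [:: r]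
  | Scan r => [:: ord0; r]
  | Seq c1 c2 => vars c1 ++ vars c2
  | If t c1 c2 => test_vars t ++ vars c1 ++ vars c2
  | For r c => r :: vars c
  end.

Fixpoint targets (c : cmd) : seq reg :=
  match c with
  | Skip => [::]
  | Inc r | Dec r | Clear r => [:: r]
  | Scan r => [:: ord0; r]
  | Seq c1 c2 | If _ c1 c2 => targets c1 ++ targets c2
  | For _ c => targets c
  end.

Fixpoint wf (c : cmd) : bool :=
  match c with
  | Scan r => r != ord0
  | Seq c1 c2 | If _ c1 c2 => wf c1 && wf c2
  | For r c => (r \notin vars c) && wf c
  | _ => true
  end.

Lemma targets_vars c : {subset targets c <= vars c}.
Proof.
elim: c => [|r|r|r|r|c1 IH1 c2 IH2|t c1 IH1 c2 IH2|r c IH] r' //=.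
- by rewrite !mem_cat => /orP[/IH1|/IH2] ->; rewrite ?orbT.
- by rewrite !mem_cat => /orP[/IH1|/IH2] ->; rewrite ?orbT.
by move/IH; rewrite inE orbC => ->.
Qed.

Section Input.
Variable s : seq bool.
Notation N := (size s).

Definition run_length (p : nat) : nat := find negb (drop p s).

Definition holds (t : test) (m : memory) : bool :=
  match t with
  | Bit => nth false s (m ord0)
  | Zero r => m r == 0
  end.

Fixpoint den (c : cmd) (m : memory) : memory :=
  match c with
  | Skip => m
  | Inc r => upd m r (minn N (m r).+1)
  | Dec r => upd m r (m r).-1
  | Clear r => upd m r 0
  | Scan r => let l := run_length (m ord0) in
              upd (upd m r (minn N (m r + l))) ord0 (m ord0 + l)
  | Seq c1 c2 => den c2 (den c1 m)
  | If t c1 c2 => if holds t m then den c1 m else den c2 m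
  | For r c => iter (m r) (den c) m
  end.

Lemma den_frame c m r : r \notin targets c -> den c m r = m r.
Proof.
elim: c m => //= [r'|r'|r'|r'|c1 IH1 c2 IH2|t c1 IH1 c2 IH2|r' c IH] m.
- by rewrite inE => ?; rewrite upd_neq.
- by rewrite inE => ?; rewrite upd_neq.
- by rewrite inE => ?; rewrite upd_neq.
- by rewrite !inE => /norP[? ?]; rewrite !upd_neq.
- by rewrite mem_cat => /norP[? ?]; rewrite IH2 // IH1.
- by rewrite mem_cat => /norP[? ?]; case: ifP => _; rewrite (IH1, IH2).
by move=> nr; elim: (m r') => //= n <-; exact: IH.
Qed.

(** Applied to a loop counter: its head moves during the loop, and the body is insensitive to
    that. *)
Lemma den_upd c m r v : r \notin vars c ->
  den c (upd m r v) = upd (den c m) r v.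
Proof.
elim: c m => //= [r'|r'|r'|r'|c1 IH1 c2 IH2|t c1 IH1 c2 IH2|r' c IH] m.
- by rewrite inE eq_sym => neq; rewrite upd_neq // updC // eq_sym.
- by rewrite inE eq_sym => neq; rewrite upd_neq // updC // eq_sym.
- by rewrite inE => neq; rewrite updC.
- rewrite !inE => /norP[neq0 neq]; rewrite !(@upd_neq m) 1?eq_sym //.
  by rewrite (updC _ _ _ neq) (updC _ _ _ neq0).
- by rewrite mem_cat => /norP[? ?]; rewrite IH1 // IH2.
- rewrite !mem_cat => /norP[nt /norP[n1 n2]].
  have -> : holds t (upd m r v) = holds t m.
    by case: t nt => [|r'] /=; rewrite inE eq_sym => neq; rewrite upd_neq.
  by case: ifP => _; rewrite (IH1, IH2).
rewrite inE => /norP[neq nin].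
rewrite upd_neq 1?eq_sym //; elim: (m r') => //= n ->.
exact: IH.
Qed.

Lemma run_length_leq p : p <= N -> p + run_length p <= N.
Proof.
move=> le_p; have := find_size negb (drop p s).
by rewrite size_drop -/(run_length p); lia.
Qed.

Lemma den_leq c m : (forall r, m r <= N) -> forall r, den c m r <= N.
Proof.
elim: c m => //= [r|r|r|r|c1 IH1 c2 IH2|t c1 IH1 c2 IH2|r c IH] m le_m.
- by move=> r'; rewrite /upd; case: eqP => // _; exact: geq_minl.
- move=> r'; rewrite /upd; case: eqP => // _.
  by rewrite (leq_trans (leq_pred _)).
- by move=> r'; rewrite /upd; case: eqP.
(* [Scan] moves [ord0] without saturation, but a block of ones ends within the input. *)
- move=> r'; rewrite /upd; case: eqP => // _; first exact: run_length_leq.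
  by case: eqP => // _; exact: geq_minl.
- by apply: IH2; apply: IH1.
- by case: ifP => _; [apply: IH1|apply: IH2].
by elim: (m r) => //= n; exact: IH.
Qed.

Lemma den_for_inv (I : nat -> memory -> Prop) r c m :
    I 0 m ->
    (forall j m', j < m r -> I j m' -> I j.+1 (den c m')) ->
  I (m r) (den (For r c) m).
Proof.
move=> I0 IS /=; elim: {-2}(m r) (leqnn (m r)) => //= n IHn lt_n.
by apply: IS (IHn _); rewrite // ltnW.
Qed.

(* Saturation at [N] commutes with adding, so a loop of additions is one. *)
Lemma den_for_add r x c g m :
    (forall m', m' x <= N -> den c m' = upd m' x (minn N (m' x + g m'))) ->
    (forall m' v, g (upd m' x v) = g m') -> m x <= N ->
  den (For r c) m = upd m x (minn N (m x + m r * g m)).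
Proof.
move=> denc gx le_x /=; elim: (m r) => [|n IHn] /=.
  by rewrite mul0n addn0 (minn_idPr _) // upd_id.
rewrite IHn denc upd_eq ?geq_minl // gx upd_upd; congr upd; lia.
Qed.

Lemma den_for_inc r x m : m x <= N ->
  den (For r (Inc x)) m = upd m x (minn N (m x + m r)).
Proof.
move=> le_x; rewrite (@den_for_add r x _ (fun=> 1)) ?muln1 // => m' _ /=.
by rewrite addn1.
Qed.

Lemma den_for_dec r x m : den (For r (Dec x)) m = upd m x (m x - m r).
Proof.
rewrite /=; elim: (m r) => [|n IHn] /=; first by rewrite subn0 upd_id.
by rewrite IHn upd_eq upd_upd subnS.
Qed.

Lemma den_inc r m : den (Inc r) m = upd m r (minn N (m r).+1).
Proof. by []. Qed.

Lemma den_clear r m : den (Clear r) m = upd m r 0.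
Proof. by []. Qed.

Lemma den_seq c1 c2 m : den (Seq c1 c2) m = den c2 (den c1 m).
Proof. by []. Qed.

Lemma den_if t c1 c2 m :
  den (If t c1 c2) m = if holds t m then den c1 m else den c2 m.
Proof. by []. Qed.

End Input.
End Commands.

(** * Compiling commands to control graphs *)

Section Compiler.
Variable k : nat.

Notation reg := 'I_k.+1.
Notation tape := 'I_(k.+1 + k.+1).

Definition input_tape : tape := lshift k.+1 ord0.

(* Register [r] is the head position on tape [lshift r]; tape [rshift r] holds
   the part of [r] already consumed by a loop over [r]. *)
Definition both A (f g : reg -> A) : tape -> A :=
  fun j => match split j with inl r => f r | inr r => g r end.

Lemma both_l A (f g : reg -> A) r : both f g (lshift k.+1 r) = f r.
Proof. by rewrite /both (unsplitK (inl r)). Qed.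

Lemma both_r A (f g : reg -> A) r : both f g (rshift k.+1 r) = g r.
Proof. by rewrite /both (unsplitK (inr r)). Qed.

Definition still : reg -> move := fun=> MoveStay.
Definition only (r : reg) (d : move) : reg -> move :=
  fun r' => if r' == r then d else MoveStay.

Definition zero_seen (v : view k) (j : tape) : bool := (v j).1.1.
Definition end_seen (v : view k) (j : tape) : bool := (v j).1.2.
Definition one_seen (v : view k) : bool := (v input_tape).2 == Some true.

Notation main r := (lshift k.+1 r).
Notation spare r := (rshift k.+1 r).

Definition test_seen (t : test k) (v : view k) : bool :=
  if t is Zero r then zero_seen v (main r) else one_seen v.

(** Each round of [For r] moves one unit from tape [main r] to tape [spare r]; a final sweep moves
    everything back, restoring the counter. *)
Fixpoint compile (c : cmd k) : graph k :=
  match c with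
  | Skip => gprim (fun v => (v, both still still, false))
  | Inc r => gprim (fun v =>
      (v, both (only r (if end_seen v (main r) then MoveStay else MoveRight))
            still, false))
  | Dec r => gprim (fun v =>
      (v, both (only r (if zero_seen v (main r) then MoveStay else MoveLeft))
            still, false))
  | Clear r => gprim (fun v =>
      if zero_seen v (main r) then (v, both still still, false)
      else (v, both (only r MoveLeft) still, true))
  | Scan r => gprim (fun v =>
      if one_seen v then
        (v, both (fun r' => if r' == ord0 then MoveRight else
                    only r (if end_seen v (main r) then MoveStay
                            else MoveRight) r') still, true)
      else (v, both still still, false))
  | Seq c1 c2 => gseq (compile c1) (compile c2)
  | If t c1 c2 => gif (test_seen t) (compile c1) (compile c2)
  | For r c =>
      gseq
        (grep (fun v =>
           if zero_seen v (main r) then (v, both still still, false)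
           else (v, both (only r MoveLeft) (only r MoveRight), true))
          (compile c))
        (gprim (fun v =>
           if zero_seen v (spare r) then (v, both still still, false)
           else (v, both (only r MoveRight) (only r MoveLeft), true)))
  end.

(** Registers are at most [n], hence so is the number of rounds of every loop. The last summand for
    [For] pays for restoring the counter. *)
Fixpoint cost (c : cmd k) (n : nat) : nat :=
  match c with
  | Skip | Inc _ | Dec _ => 1
  | Clear _ | Scan _ => n.+1
  | Seq c1 c2 => cost c1 n + cost c2 n
  | If _ c1 c2 => 1 + cost c1 n + cost c2 n
  | For _ c => (n * (cost c n).+1).+1 + n.+1
  end.

Section Input.
Variable s : seq bool.
Notation N := (size s).

(** The flags [z] and [e] tell whether cells [0] and [N] have been marked yet. *)
Definition content (z e : bool) (j : tape) (p : int) : symbol :=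
  match p with
  | Posz i => (z && (i == 0), e && (i == N),
               if j == input_tape then nth None (map Some s) i else None)
  | Negz _ => (false, false, None)
  end.

Definition at_pos (z e : bool) (pos : tape -> nat) : store k :=
  Store (content z e) (fun j => Posz (pos j)).

Definition moven (d : move) (p : nat) : nat :=
  match d with MoveLeft => p.-1 | MoveStay => p | MoveRight => p.+1 end.

Lemma store_ext (x y : store k) :
  cells x =2 cells y -> heads x =1 heads y -> x = y.
Proof.
case: x y => [c h] [c' h'] /= eqc /functional_extensionality ->.
congr Store; apply: functional_extensionality => j.
exact/functional_extensionality/eqc.
Qed.

(** A move left agrees with the predecessor on [nat] only from a positive position. *)
Lemma perform_at z e pos d :
    (forall j, d j = MoveLeft -> 0 < pos j) ->
  perform (look (at_pos z e pos), d) (at_pos z e pos) =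
  at_pos z e (fun j => moven (d j) (pos j)).
Proof.
move=> left_gt0; apply: store_ext => [j p|j] /=.
  by case: eqP => // ->; rewrite ffunE.
by have := left_gt0 j; case: (d j) => //= [/(_ erefl)|_]; lia.
Qed.

Definition registers (h g : memory k) : store k := at_pos true true (both h g).

Lemma zero_seen_main h g r :
  zero_seen (look (registers h g)) (main r) = (h r == 0).
Proof. by rewrite /zero_seen ffunE /= both_l. Qed.

Lemma zero_seen_spare h g r :
  zero_seen (look (registers h g)) (spare r) = (g r == 0).
Proof. by rewrite /zero_seen ffunE /= both_r. Qed.

Lemma end_seen_main h g r :
  end_seen (look (registers h g)) (main r) = (h r == N).
Proof. by rewrite /end_seen ffunE /= both_l. Qed.

Lemma one_seenE h g :
  one_seen (look (registers h g)) = nth false s (h ord0).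
Proof.
rewrite /one_seen ffunE /= both_l.
have [lt_h|le_h] := ltnP (h ord0) N.
  by rewrite (nth_map false) //; case: nth.
by rewrite !nth_default ?size_map.
Qed.

Lemma test_seenE t h g : test_seen t (look (registers h g)) = holds s t h.
Proof. by case: t => [|r] /=; rewrite (one_seenE, zero_seen_main). Qed.

Lemma perform_registers h g d d' h' g' :
    (forall r, d r = MoveLeft -> 0 < h r) ->
    (forall r, d' r = MoveLeft -> 0 < g r) ->
    (forall r, moven (d r) (h r) = h' r) ->
    (forall r, moven (d' r) (g r) = g' r) ->
  perform (look (registers h g), both d d') (registers h g) = registers h' g'.
Proof.
move=> dh dg eh eg; rewrite perform_at => [|j].
  apply: store_ext => //= j.
  by rewrite /both; case: split => r; rewrite (eh, eg).
by rewrite /both; case: split => r; [apply: dh|apply: dg].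
Qed.

Lemma perform_still h g :
  perform (look (registers h g), both still still) (registers h g) =
  registers h g.
Proof. exact: perform_registers. Qed.

Lemma runs_once f d d' h g h' g' :
    f (look (registers h g)) = (look (registers h g), both d d', false) ->
    perform (look (registers h g), both d d') (registers h g) =
      registers h' g' ->
  runs (gprim f) 1 (registers h g) (registers h' g').
Proof.
by move=> fE <-; apply: (@runs_prim _ f (fun=> registers h g) 0).
Qed.

(** Only the spare heads of registers mentioned by [c] must start at cell [0]. The others are
    arbitrary, since inside a loop the spare head of the enclosing counter holds the number of
    rounds begun. *)
Lemma compile_correct c h g :
    wf c -> (forall r, h r <= N) -> (forall r, r \in vars c -> g r = 0) ->
  runs (compile c) (cost c N) (registers h g) (registers (den s c h) g).
Proof.
elim: c h g => [|r|r|r|r|c1 IH1 c2 IH2|t c1 IH1 c2 IH2|r c IH] h g wfc le_h g0.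
- by apply: runs_once => //; apply: perform_still.
- apply: runs_once; first by [].
  rewrite end_seen_main; apply: perform_registers => // r'.
    by rewrite /only; do 2?case: ifP.
  have := le_h r; rewrite /= /only /upd; case: (eqVneq r' r) => // ->.
  by case: eqP => /= ? ?; lia.
- apply: runs_once; first by [].
  rewrite zero_seen_main; apply: perform_registers => // r'.
    by rewrite /only; case: (eqVneq r' r) => // ->; case: eqP => //; lia.
  rewrite /= /only /upd; case: (eqVneq r' r) => // ->.
  by case: eqP => /= ?; lia.
- pose xs i := registers (upd h r (h r - i)) g.
  have -> : registers h g = xs 0 by rewrite /xs subn0 upd_id.
  have -> : registers (den s (Clear r) h) g =
      perform (look (xs (h r)), both still still) (xs (h r)).
    by rewrite perform_still /xs subnn.
  apply: (@runs_leq _ _ (h r).+1); first exact: le_h.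
  apply: runs_prim => [i lt_i|]; rewrite /xs zero_seen_main upd_eq.
    rewrite subn_eq0 leqNgt lt_i /=; eexists; first by [].
    apply: perform_registers => // r'; rewrite /only /upd;
      case: eqP => //= _; lia.
  by rewrite subnn.
- rewrite /= in wfc.
  set l := run_length s (h ord0).
  pose xs i := registers (upd (upd h r (minn N (h r + i))) ord0 (h ord0 + i)) g.
  have -> : registers h g = xs 0.
    by rewrite /xs !addn0 (minn_idPr _) // !upd_id.
  have -> : registers (den s (Scan r) h) g =
      perform (look (xs l), both still still) (xs l).
    by rewrite perform_still.
  have le_l := run_length_leq (le_h ord0); rewrite -/l in le_l.
  apply: (@runs_leq _ _ l.+1); first by rewrite /=; lia.
  apply: runs_prim => [i lt_i|]; rewrite /xs one_seenE upd_eq.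
    have -> : nth false s (h ord0 + i) = true.
      by have := before_find false lt_i; rewrite nth_drop => /negbFE.
    eexists; first by [].
    rewrite end_seen_main upd_neq // upd_eq.
    apply: perform_registers => // r'; rewrite /only /upd /=.
      by do 3?case: ifP.
    case: eqP => //= [_|_]; first lia.
    by case: eqP => //= _; case: eqP => /=; lia.
  (* Behind the block there is either a zero or the end of the input, where [nth] defaults to
     [false]. *)
  suff -> : nth false s (h ord0 + l) = false by [].
  rewrite -nth_drop /l /run_length.
  have [hasn|] := boolP (has negb (drop (h ord0) s)).
    by apply/negbTE/(nth_find false hasn).
  by move=> hasn; rewrite hasNfind // nth_default.
- have /andP[wf1 wf2] := wfc.
  apply: runs_seq (IH1 _ _ wf1 le_h _) (IH2 _ _ wf2 _ _) => [r in_r||r in_r].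
  + by apply: g0; rewrite mem_cat in_r.
  + exact: den_leq.
  + by apply: g0; rewrite mem_cat in_r orbT.
- have /andP[wf1 wf2] := wfc; apply: runs_if.
  have -> : perform (look (registers h g), fun=> MoveStay) (registers h g) =
            registers h g.
    rewrite -[RHS]perform_still; congr (perform (_, _)).
    by apply: functional_extensionality => j; rewrite /both; case: split.
  rewrite test_seenE /=; case: (holds s t h).
    by apply: IH1 => // r in_r; apply: g0; rewrite /= !mem_cat in_r orbT.
  by apply: IH2 => // r in_r; apply: g0; rewrite /= !mem_cat in_r !orbT.
have /= /andP[nin wf'] := wfc.
have gr : g r = 0 by apply: g0; rewrite inE eqxx.
have le_it i : forall r', iter i (den s c) h r' <= N.
  by elim: i => //= i; exact: den_leq.
have it_r i : iter i (den s c) h r = h r.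
  elim: i => //= i IHi; rewrite den_frame //.
  by apply: contra nin; exact: targets_vars.
(* [xs i] is the store after [i] rounds, with [i] units on the spare tape; [ys i] is the store once
   [i] units have been moved back. *)
pose xs i := registers (upd (iter i (den s c) h) r (h r - i)) (upd g r i).
pose ys i := registers (upd (iter (h r) (den s c) h) r i) (upd g r (h r - i)).
have xsys : xs (h r) = ys 0 by rewrite /xs /ys subnn subn0.
have updg : upd g r 0 = g by rewrite -gr upd_id.
have -> : registers h g = xs 0 by rewrite /xs subn0 updg upd_id.
have ysE : ys (h r) = registers (den s (For r c) h) g.
  by rewrite /ys subnn updg -{2}(it_r (h r)) upd_id.
apply: (@runs_leq _ _ ((h r * (cost c N).+1).+1 + (h r).+1)).
  have := le_h r; rewrite /= => le_r.
  by apply: leq_add; rewrite ltnS ?leq_mul2r ?le_r ?orbT.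
apply: (@runs_seq _ _ _ _ _ _ (ys 0)).
  rewrite -xsys.
  have -> : xs (h r) = perform (look (xs (h r)), both still still) (xs (h r)).
    by rewrite perform_still.
  apply: runs_rep => [i lt_i|]; rewrite /xs zero_seen_main upd_eq;
    last by rewrite subnn.
  rewrite subn_eq0 leqNgt lt_i /=; eexists; first by [].
  rewrite (@perform_registers _ _ _ _
    (upd (iter i (den s c) h) r (h r - i.+1)) (upd g r i.+1)).
  (* The body runs with a lowered counter; not mentioning [r], it commutes with the lowering. *)
  + rewrite -den_upd //; apply: IH => // r'.
      rewrite /upd; case: eqP => // _; have := le_h r; lia.
    move=> in_r; rewrite upd_neq ?g0 ?inE ?in_r ?orbT //.
    by apply: contraNneq nin => <-.
  + by move=> r'; rewrite /only /upd; case: eqP => //= _; lia.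
  + by move=> r'; rewrite /only; case: eqP.
  + by move=> r'; rewrite /only /upd; case: eqP => //= _; lia.
  + by move=> r'; rewrite /only /upd; case: eqP => //= _; lia.
have -> : registers (den s (For r c) h) g =
    perform (look (ys (h r)), both still still) (ys (h r)).
  by rewrite perform_still -ysE.
apply: runs_prim => [i lt_i|]; rewrite /ys zero_seen_spare upd_eq;
    last by rewrite subnn.
rewrite subn_eq0 leqNgt lt_i /=; eexists; first by [].
apply: perform_registers => r'; rewrite /only /upd; case: eqP => //= _; lia.
Qed.
End Input.
End Compiler.

(** * Marking cells [0] and [N] *)

Section Boot.
Variable k : nat.
Notation tape := 'I_(k.+1 + k.+1).
Notation input := (@input_tape k).

Definition mark_start : graph k :=
  gprim (fun v => ([ffun j => (true, (v j).1.2, (v j).2)],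
                   fun=> MoveStay, false)).

(** All heads move in lockstep with the input head, so every tape is marked at cell [N], the first
    one without an input bit. *)
Definition mark_end : graph k :=
  gprim (fun v =>
    if (v input).2 then (v, fun=> MoveRight, true)
    else ([ffun j => ((v j).1.1, true, (v j).2)], fun=> MoveStay, false)).

Definition rewind : graph k :=
  gprim (fun v =>
    if zero_seen v input then (v, fun=> MoveStay, false)
    else (v, fun=> MoveLeft, true)).

Definition boot : graph k := gseq mark_start (gseq mark_end rewind).

Variable s : seq bool.
Notation N := (size s).
Notation pos z e i := (@at_pos k s z e (fun=> i)).

Lemma runs_boot :
  runs boot (1 + (N.+1 + N.+1)) (pos false false 0)
    (registers s (fun=> 0) (fun=> 0)).
Proof.
have -> : registers s (fun=> 0) (fun=> 0) = pos true true 0.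
  by apply: store_ext => //= j; rewrite /both; case: split.
apply: (@runs_seq _ _ _ _ _ _ (pos true false 0)).
  have -> : pos true false 0 =
      perform ([ffun j => (true, (look (pos false false 0) j).1.2,
                           (look (pos false false 0) j).2)],
               fun=> MoveStay) (pos false false 0).
    apply: store_ext => //= j [] // [|i] //=; by rewrite !ffunE.
  exact: (@runs_prim _ _ (fun=> pos false false 0) 0).
apply: (@runs_seq _ _ _ _ _ _ (pos true true N)).
  have -> : pos true true N =
      perform ([ffun j => ((look (pos true false N) j).1.1, true,
                           (look (pos true false N) j).2)],
               fun=> MoveStay) (pos true false N).
    apply: store_ext => //= j [i|//] /=; rewrite !ffunE /=.
    rewrite -[Posz i == _]/(i == N).
    by case: (eqVneq i N) => // ->.
  apply: (@runs_prim _ _ (fun i => pos true false i) N) => [i lt_i|].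
    rewrite ffunE /= (nth_map false) //; eexists; first by [].
    by rewrite perform_at.
  by rewrite ffunE /= nth_default // size_map.
rewrite /rewind; set f := (X in gprim X).
have := @runs_prim _ f (fun i => pos true true (N - i)) N
  (look (pos true true 0), fun=> MoveStay).
rewrite /= subn0 subnn perform_at //; apply=> [i lt_i|]; rewrite /f.
  rewrite /zero_seen ffunE /= subn_eq0 leqNgt lt_i; eexists; first by [].
  rewrite perform_at /= => [|_ _]; last by rewrite subn_gt0.
  by rewrite -subnS.
by rewrite /zero_seen ffunE.
Qed.

End Boot.

(** * Polynomial running time *)

Section Program.
Variables (k : nat) (c : cmd k) (flag : 'I_k.+1).

Definition program_machine : turing_machine :=
  machine (gseq (boot k) (compile c)) (lshift k.+1 flag).

Lemma cost_poly (d : cmd k) :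
  exists p : {poly nat}, forall n, (p.[n])%R = cost d n.
Proof.
elim: d => [|r|r|r|r|c1 [p1 p1E] c2 [p2 p2E]
  |t c1 [p1 p1E] c2 [p2 p2E]|r d [p pE]] /=.
- by exists 1%:P%R => n; rewrite hornerC.
- by exists 1%:P%R => n; rewrite hornerC.
- by exists 1%:P%R => n; rewrite hornerC.
- by exists ('X + 1%:P)%R => n; rewrite hornerD hornerX hornerC; lia.
- by exists ('X + 1%:P)%R => n; rewrite hornerD hornerX hornerC; lia.
- by exists (p1 + p2)%R => n; rewrite hornerD p1E p2E.
- by exists (1%:P + p1 + p2)%R => n; rewrite !hornerD hornerC p1E p2E.
exists ('X * (p + 1%:P) + 'X + 1%:P + 1%:P)%R => n.
by rewrite !hornerD !hornerM !hornerD !hornerX !hornerC pE; lia.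
Qed.

Lemma init_program s : init program_machine s =
  @Config program_machine (tm_start program_machine)
    (cells (@at_pos k s false false (fun=> 0)))
    (heads (@at_pos k s false false (fun=> 0))).
Proof.
congr Config.
apply: functional_extensionality => j.
apply: functional_extensionality => - [i|i] //=.
have -> : (j == ord0 :> 'I_(k + k.+1).+1) = (j == input_tape k).
  by rewrite -!val_eqE.
case: eqP => // _; rewrite -/(symbol_bit _).
have [lt_i|le_i] := ltnP i (size s); first by rewrite !(nth_map false).
by rewrite !nth_default ?size_map.
Qed.

Lemma program_polytime : wf c ->
  exists p : {poly nat}, forall s : seq bool,
    let y := iter (p.[size s])%R (@step program_machine)
                  (init program_machine s) in
    halted y /\ accepts y = (den s c (fun=> 0) flag == 0).
Proof.
move=> wfc; have [p pE] := cost_poly c.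
(* Marking takes at most [2 * N + 3] steps, and one more leads from the exit of the graph to the
   verdict. *)
exists (p + 'X + 'X + 4%:P)%R => s.
have [t le_t ex] : runs (gseq (boot k) (compile c))
    (1 + ((size s).+1 + (size s).+1) + cost c (size s))
    (at_pos s false false (fun=> 0))
    (registers s (den s c (fun=> 0)) (fun=> 0)).
  apply: runs_seq (runs_boot k s) _.
  exact: compile_correct.
have := machine_exec (lshift k.+1 flag) ex.
set x := Config _ _ _ => iter_t.
have [r ->] : exists r, (p + 'X + 'X + 4%:P).[size s]%R = r + t.+1.
  rewrite !hornerD !hornerX hornerC pE.
  exists (cost c (size s) + size s + size s + 4 - t.+1).
  by rewrite subnK //; lia.
rewrite iterD iterS init_program iter_t.
set z := (z in iter r _ z).
have [hz az] : halted z /\ accepts z = (den s c (fun=> 0) flag == 0).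
  by rewrite -(zero_seen_main s _ (fun=> 0) flag).
(* The surplus steps of the bound are spent in a halted configuration, which is a fixed point. *)
have -> : iter r (@step program_machine) z = z.
  by elim: r => //= r ->; rewrite {1}/step hz.
by [].
Qed.
End Program.

(** * The program *)

Local Notation reg := 'I_18.

(* A loop may not mention its own counter in its body, hence the copies
   [size2], [size_w], [size_d], [size_b] of the number [size1] of alternatives.
   The entry of vote [vote] at row [x], column [y] is input cell
   [base + vote * size1 * size2 + x * size1 + y]. *)
Definition cursor : reg := ord0.
Definition size1 : reg := @Ordinal 18 1 isT.
Definition size2 : reg := @Ordinal 18 2 isT.
Definition size_w : reg := @Ordinal 18 3 isT.
Definition size_d : reg := @Ordinal 18 4 isT.
Definition size_b : reg := @Ordinal 18 5 isT.
Definition votes : reg := @Ordinal 18 6 isT.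
Definition base : reg := @Ordinal 18 7 isT.
Definition cand : reg := @Ordinal 18 8 isT.
Definition alt_w : reg := @Ordinal 18 9 isT.
Definition alt_d : reg := @Ordinal 18 10 isT.
Definition alt_b : reg := @Ordinal 18 11 isT.
Definition vote : reg := @Ordinal 18 12 isT.
Definition forced : reg := @Ordinal 18 13 isT.
Definition beaten : reg := @Ordinal 18 14 isT.
Definition diff : reg := @Ordinal 18 15 isT.
Definition tie : reg := @Ordinal 18 16 isT.
Definition found : reg := @Ordinal 18 17 isT.

Local Infix ";;" := Seq (at level 60, right associativity).

Definition Read (x y : reg) : cmd 17 :=
  Clear cursor ;; For base (Inc cursor) ;;
  For vote (For size1 (For size2 (Inc cursor))) ;;
  For x (For size1 (Inc cursor)) ;; For y (Inc cursor).

Definition Sub (x y : reg) : cmd 17 :=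
  Clear diff ;; For x (Inc diff) ;; For y (Dec diff).

Definition IfNeq (x y : reg) (c : cmd 17) : cmd 17 :=
  Sub x y ;; If (Zero diff) (Sub y x ;; If (Zero diff) (Skip _) c) c.

(** The nested tests evaluate [must_beat] and [can_beat]; once [O c d] holds, the latter reduces to
    [~~ O b w]. *)
Definition CheckVote : cmd 17 :=
  Read cand alt_d ;;
  If (Bit _)
    (Inc forced ;; Read alt_b alt_w ;; If (Bit _) (Skip _) (Inc beaten))
    (Read alt_b alt_w ;;
     If (Bit _) (Skip _)
       (Read cand alt_w ;;
        If (Bit _) (Read alt_b alt_d ;; If (Bit _) (Skip _) (Inc beaten))
          (Inc beaten))).

Definition CountVotes : cmd 17 :=
  Clear forced ;; Clear beaten ;; Clear vote ;;
  For votes (CheckVote ;; Inc vote).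

(** By truncated subtraction, [forced] ends at zero exactly when it did not exceed [beaten]. *)
Definition CheckOpponent : cmd 17 :=
  CountVotes ;; For beaten (Dec forced) ;;
  If (Zero forced) (Skip _) (IfNeq alt_b alt_w (Clear tie)) ;;
  Inc alt_b.

Definition CheckPair : cmd 17 :=
  Clear tie ;; Inc tie ;; Clear alt_b ;; For size_b CheckOpponent ;;
  IfNeq alt_w cand (IfNeq alt_d cand (If (Zero tie) (Skip _) (Inc found))) ;;
  Inc alt_d.

Definition CheckRival : cmd 17 :=
  Clear alt_d ;; For size_d CheckPair ;; Inc alt_w.

(** Each [Inc cursor] skips the [false] that ends a unary number; the final cursor, saved in [base],
    is where the matrices begin. *)
Definition Parse : cmd 17 :=
  Scan size1 ;; Inc cursor ;; Scan cand ;; Inc cursor ;;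
  Scan votes ;; Inc cursor ;;
  For cursor (Inc base) ;;
  For size1 (Inc size2) ;; For size1 (Inc size_w) ;; For size1 (Inc size_d) ;;
  For size1 (Inc size_b).

Definition Main : cmd 17 := Parse ;; For size_w CheckRival.

Lemma wf_Main : wf Main. Proof. by []. Qed.

(** * Correctness of the program *)

Section Semantics.
Variable s : seq bool.
Notation N := (size s).
Notation den := (den s).

Definition address (m : memory 17) (x y : reg) : nat :=
  m base + m vote * (m size1 * m size2) + m x * m size1 + m y.

Definition read_bit (m : memory 17) (x y : reg) : bool :=
  nth false s (address m x y).

(** A saturated address is harmless: cell [N] reads as [false], like every address beyond it. *)
Lemma nth_minn i : nth false s (minn N i) = nth false s i.
Proof.
by have [le_i|/ltnW le_i] := leqP N i; rewrite // !nth_default.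
Qed.

Lemma den_Read x y m : x != cursor -> y != cursor ->
  den (Read x y) m = upd m cursor (minn N (address m x y)).
Proof.
move=> xh yh; rewrite !den_seq.
rewrite [den (Clear _) m]/= (@den_for_inc _ _ base) ?upd_eq // upd_upd.
rewrite upd_neq //.
rewrite add0n.
set m1 := upd m _ _.
have inner m' : m' cursor <= N -> den (For size1 (For size2 (Inc cursor))) m' =
    upd m' cursor (minn N (m' cursor + m' size1 * m' size2)).
  move=> le_h.
  rewrite (@den_for_add _ _ size1 cursor _ (fun m' => m' size2)) // => m'' le_h'.
  exact: den_for_inc.
rewrite (@den_for_add _ _ vote cursor _ (fun m' => m' size1 * m' size2)) //;
  last first.
  by rewrite /m1 upd_eq geq_minl.
rewrite upd_upd (@den_for_add _ _ x cursor _ (fun m' => m' size1)) ?upd_eq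
  ?geq_minl //;
  last by move=> m' le_h; exact: den_for_inc.
rewrite den_for_inc ?upd_eq ?geq_minl // /m1 !upd_upd.
rewrite !upd_eq !upd_neq //; congr upd; rewrite /address; lia.
Qed.

Lemma den_Sub x y m : x != diff -> y != diff -> m x <= N ->
  den (Sub x y) m = upd m diff (m x - m y).
Proof.
move=> xd yd le_x; rewrite !den_seq [den (Clear _) m]/=.
rewrite den_for_inc ?upd_eq // den_for_dec !upd_upd !upd_eq !upd_neq //.
by congr upd; lia.
Qed.

(** The value [v] left in the scratch register [diff] is kept abstract, as every [Sub] starts by
    clearing it. *)
Lemma den_IfNeq x y c m : x != diff -> y != diff -> m x <= N -> m y <= N ->
  exists v, den (IfNeq x y c) m =
    if m x == m y then upd m diff v else den c (upd m diff v).
Proof.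
move=> xd yd le_x le_y; rewrite /IfNeq den_seq den_if den_Sub //.
rewrite [holds _ _ _]/= upd_eq subn_eq0 den_seq den_if.
have [lt_y|le_xy] := ltnP (m y) (m x).
  by exists (m x - m y); rewrite gtn_eqF // ltnNge.
rewrite den_Sub ?upd_neq // [holds _ _ _]/= upd_upd upd_eq subn_eq0.
by exists (m y - m x); rewrite eqn_leq le_xy.
Qed.

Definition forced_bit (m : memory 17) : bool := read_bit m cand alt_d.

Definition beaten_bit (m : memory 17) : bool :=
  ~~ read_bit m alt_b alt_w &&
  ~~ [&& read_bit m cand alt_w, ~~ read_bit m cand alt_d
       & read_bit m alt_b alt_d].

Lemma read_bit_upd x y m r v :
    [&& r != base, r != vote, r != size1, r != size2, r != x & r != y] ->
  read_bit (upd m r v) x y = read_bit m x y.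
Proof.
case/and5P => ? ? ? ? /andP[? ?].
by rewrite /read_bit /address !upd_neq // eq_sym.
Qed.

Lemma holds_Read m v x y : v = minn N (address m x y) ->
  holds s (Bit _) (upd m cursor v) = read_bit m x y.
Proof. by move=> ->; rewrite /= upd_eq nth_minn. Qed.

Lemma den_CheckVote m :
  den CheckVote m forced =
    (if forced_bit m then minn N (m forced).+1 else m forced) /\
  den CheckVote m beaten =
    (if beaten_bit m then minn N (m beaten).+1 else m beaten).
Proof.
rewrite /CheckVote /beaten_bit /forced_bit.
rewrite den_seq den_Read // den_if (holds_Read (erefl _)).
case: ifP => _.
  rewrite 2!den_seq [den (Inc _) _]/= den_Read // den_if (holds_Read (erefl _)).
  rewrite !read_bit_upd // !andbF andbT.
  by case: read_bit; rewrite /upd /=.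
rewrite den_seq den_Read // den_if (holds_Read (erefl _)) !read_bit_upd //.
case: ifP => _; first by rewrite /upd /=.
rewrite den_seq den_Read // den_if (holds_Read (erefl _)) !read_bit_upd //.
case: ifP => _; last by rewrite /upd /=.
rewrite den_seq den_Read // den_if (holds_Read (erefl _)) !read_bit_upd //.
by case: ifP => _; rewrite /upd /=.
Qed.

Section Loops.
Variables (m0 : memory 17) (alts num cnd : nat).
Variable o : nat -> nat -> nat -> bool.

(** These are set by [Parse] and have the same values after each later command; serving as a loop
    counter does not change them. *)
Definition constants : seq reg :=
  [:: size1; size2; size_w; size_d; size_b; votes; base; cand].

Hypotheses
  (m0_size : forall r, r \in [:: size1; size2; size_w; size_d; size_b] ->
     m0 r = alts)
  (m0_votes : m0 votes = num) (m0_cand : m0 cand = cnd) (cnd_lt : cnd < alts)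
  (size_leq : alts <= N) (num_leq : num <= N) (N_gt0 : 0 < N).
Hypothesis s_matrix : forall i x y, i < num -> x < alts -> y < alts ->
  nth false s (m0 base + i * (alts * alts) + x * alts + y) = o i x y.

Definition same_env (m : memory 17) : Prop := {in constants, m =1 m0}.

Lemma same_env_den c m :
    all (fun r => r \notin targets c) constants ->
  same_env m -> same_env (den c m).
Proof.
by move=> /allP fr env r in_r; rewrite den_frame ?env //; apply: fr.
Qed.

Lemma read_bitE m x y : same_env m ->
  m vote < num -> m x < alts -> m y < alts ->
  read_bit m x y = o (m vote) (m x) (m y).
Proof.
move=> env *; rewrite /read_bit /address.
rewrite (env base) // (env size1) // (env size2) //.
by rewrite (@m0_size size1) // (@m0_size size2) // s_matrix.
Qed.

Definition must (d i : nat) : bool := o i cnd d.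
Definition can (w d b i : nat) : bool :=
  ~~ o i b w && ~~ [&& o i cnd w, ~~ o i cnd d & o i b d].

Definition selects (m : memory 17) (w d : nat) : Prop :=
  [/\ same_env m, m alt_w = w, m alt_d = d, w < alts & d < alts].

Lemma selects_den c m w d :
    all (fun r => r \notin targets c) [:: alt_w, alt_d & constants] ->
  selects m w d -> selects (den c m) w d.
Proof.
move=> /and3P[fw fd fc] [env mw md lt_w lt_d].
by split; rewrite ?den_frame //; apply: same_env_den.
Qed.

Lemma sum_bool_leq j (f : nat -> bool) : \sum_(i < j) f i <= j.
Proof.
elim: j => [|j IHj]; first by rewrite big_ord0.
by rewrite big_ord_recr /= -[j.+1]addn1 leq_add ?leq_b1.
Qed.

Lemma den_CountVotes m w d b : selects m w d -> m alt_b = b -> b < alts ->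
  den CountVotes m forced = \sum_(i < num) must d i /\
  den CountVotes m beaten = \sum_(i < num) can w d b i.
Proof.
move=> sel mb lt_b; rewrite /CountVotes !den_seq.
set m1 := den (Clear vote) _.
have sel1 : selects m1 w d by rewrite /m1; do 3!apply: selects_den => //.
have mb1 : m1 alt_b = b by rewrite /m1 !den_frame.
have m1_votes : m1 votes = num by case: sel1 => env *; rewrite env.
pose I j (m' : memory 17) := [/\ selects m' w d, m' alt_b = b, m' vote = j,
  m' forced = \sum_(i < j) must d i & m' beaten = \sum_(i < j) can w d b i].
suff : I (m1 votes) (den (For votes (CheckVote;; Inc vote)) m1).
  by rewrite m1_votes => - [].
apply: den_for_inv; first by split; rewrite ?big_ord0.
rewrite m1_votes => j m' lt_j [sel' mb' m'j mf mo].
have [env' mw' md' lt_w lt_d] := sel'.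
have [env_c cnd_r] : m' cand = cnd /\ m' cand < alts.
  by rewrite env' // m0_cand.
have [cf cb] := den_CheckVote m'.
have fE : forced_bit m' = must d j.
  by rewrite /forced_bit read_bitE ?m'j ?md' // env_c.
have bE : beaten_bit m' = can w d b j.
  by rewrite /beaten_bit !read_bitE ?m'j ?md' ?mw' ?mb' // env_c.
split.
- exact: selects_den.
- by rewrite den_frame.
- rewrite den_seq den_inc upd_eq den_frame // m'j; lia.
- rewrite den_seq den_inc upd_neq // cf fE mf big_ord_recr /=.
  (* At most [j < num <= N] votes have been counted, so the increment does not saturate. *)
  by have := sum_bool_leq j (must d); case: must => /=; lia.
rewrite den_seq den_inc upd_neq // cb bE mo big_ord_recr /=.
by have := sum_bool_leq j (can w d b); case: can => /=; lia.
Qed.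

Definition unbeaten (w d b : nat) : bool :=
  (b == w) || (\sum_(i < num) must d i <= \sum_(i < num) can w d b i).

Lemma den_CheckOpponent m w d b : selects m w d -> m alt_b = b -> b < alts ->
  den CheckOpponent m tie = (if unbeaten w d b then m tie else 0) /\
  den CheckOpponent m alt_b = b.+1.
Proof.
move=> sel mb lt_b; have [cf cb] := den_CountVotes sel mb lt_b.
have [env mw _ lt_w _] := sel.
rewrite /CheckOpponent 3!den_seq den_for_dec cf cb.
set F := \sum_(i < num) _; set G := \sum_(i < num) _.
set m1 := upd _ _ _.
have m1w : m1 alt_w = w by rewrite /m1 upd_neq // den_frame.
have m1b : m1 alt_b = b by rewrite /m1 upd_neq // den_frame.
have m1t : m1 tie = m tie by rewrite /m1 upd_neq // den_frame.
split; last by rewrite den_inc upd_eq den_frame // m1b; lia.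
rewrite den_inc upd_neq // den_if [holds _ _ _]/= {1}/m1 upd_eq.
rewrite /unbeaten -/F -/G subn_eq0.
case: leqP => _; first by rewrite orbT /= m1t.
have [||v ->] := @den_IfNeq alt_b alt_w (Clear tie) m1 isT isT; try lia.
by rewrite m1b m1w orbF; case: eqP => _; rewrite /upd /= ?m1t.
Qed.

Definition tying (w d : nat) : bool :=
  [&& w != cnd, d != cnd & all (unbeaten w d) (iota 0 alts)].

Lemma den_CheckPair m w d : selects m w d ->
  den CheckPair m found =
    (if tying w d then minn N (m found).+1 else m found) /\
  den CheckPair m alt_d = d.+1.
Proof.
move=> sel; rewrite /CheckPair 4!den_seq.
set m1 := den (Clear alt_b) _.
have sel1 : selects m1 w d by rewrite /m1; do 3!apply: selects_den => //.
have m1_size : m1 size_b = alts by case: sel1 => env *; rewrite env // m0_size.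
set m2 := den (For _ _) m1.
have sel2 : selects m2 w d by apply: selects_den.
have m2_tie : m2 tie = all (unbeaten w d) (iota 0 alts).
  pose I j (m' : memory 17) := [/\ selects m' w d, m' alt_b = j &
                                m' tie = all (unbeaten w d) (iota 0 j)].
  suff : I (m1 size_b) m2 by rewrite m1_size => - [].
  (* [Inc tie] yields exactly [1], because [0 < N]. *)
  apply: den_for_inv; first by split; rewrite // /m1 /= /upd /=; lia.
  rewrite m1_size => j m' lt_j [sel' mb' mt'].
  have [ct cb] := den_CheckOpponent sel' mb' lt_j.
  split=> //; first exact: selects_den.
  rewrite ct mt' -[j.+1]addn1 iotaD all_cat /= andbT add0n.
  by case: unbeaten; rewrite ?andbT ?andbF.
have m2f : m2 found = m found by rewrite /m2 /m1 !den_frame.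
have [env mw md lt_w lt_d] := sel2.
have mc : m2 cand = cnd by rewrite env.
split; last by rewrite den_seq den_inc upd_eq den_frame // md; lia.
rewrite den_seq den_inc upd_neq // /tying.
have [||v ->] := @den_IfNeq alt_w cand
  (IfNeq alt_d cand (If (Zero tie) (Skip _) (Inc found))) m2 isT isT; try lia.
rewrite mw mc; case: eqP => _; first by rewrite upd_neq.
set m3 := upd _ _ _.
have m3d : m3 alt_d = d by rewrite /m3 upd_neq.
have m3c : m3 cand = cnd by rewrite /m3 upd_neq.
have m3f : m3 found = m found by rewrite /m3 upd_neq.
have m3t : m3 tie = all (unbeaten w d) (iota 0 alts) by rewrite /m3 upd_neq.
have [||v' ->] := @den_IfNeq alt_d cand (If (Zero tie) (Skip _) (Inc found)) m3
  isT isT; try lia.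
rewrite m3d m3c; case: eqP => _; first by rewrite upd_neq.
by rewrite /= upd_neq // m3t; case: all; rewrite /= ?upd_eq upd_neq // m3f.
Qed.

Definition tie_found (w : nat) : bool := has (tying w) (iota 0 alts).

(** Saturation may lose the number of tying pairs, but not whether it is zero, because [0 < N]. *)
Lemma den_CheckRival m w : same_env m -> m alt_w = w -> w < alts ->
  (den CheckRival m found == 0) = (m found == 0) && ~~ tie_found w /\
  den CheckRival m alt_w = w.+1.
Proof.
move=> env mw lt_w; rewrite /CheckRival 2!den_seq den_clear.
set m1 := upd m _ _.
have m1_size : m1 size_d = alts by rewrite /m1 upd_neq // env // m0_size.
pose I j (m' : memory 17) := [/\ same_env m', m' alt_w = w, m' alt_d = j &
  (m' found == 0) = (m found == 0) && ~~ has (tying w) (iota 0 j)].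
have [] : I (m1 size_d) (den (For size_d CheckPair) m1).
  apply: den_for_inv.
    split; rewrite /m1 ?upd_eq ?upd_neq // ?andbT //.
    by apply: (@same_env_den (Clear alt_d)).
  rewrite m1_size => j m' lt_j [env' mw' md' mf'].
  have sel : selects m' w j by split.
  have [cf cd] := den_CheckPair sel.
  split=> //; [exact: same_env_den|by rewrite den_frame|].
  rewrite cf -[j.+1]addn1 iotaD has_cat /= orbF add0n negb_or andbA -mf'.
  by case: tying; rewrite ?andbT ?andbF //; lia.
rewrite m1_size => env' mw' _ mf'.
by split; rewrite den_inc ?upd_eq ?upd_neq // mw'; lia.
Qed.

Lemma den_rivals m : same_env m -> m alt_w = 0 -> m found = 0 ->
  (den (For size_w CheckRival) m found == 0) =
    ~~ has tie_found (iota 0 alts).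
Proof.
move=> env mw mf.
have m_size : m size_w = alts by rewrite env // m0_size.
pose I j (m' : memory 17) := [/\ same_env m', m' alt_w = j &
  (m' found == 0) = ~~ has tie_found (iota 0 j)].
have [] // : I (m size_w) (den (For size_w CheckRival) m).
  apply: den_for_inv; first by split; rewrite ?mf.
  rewrite m_size => j m' lt_j [env' mw' mf'].
  have [cf cw] := den_CheckRival env' mw' lt_j.
  split=> //; first exact: same_env_den.
  by rewrite cf mf' -[j.+1]addn1 iotaD has_cat /= orbF add0n negb_or.
by rewrite m_size.
Qed.

End Loops.

(** * Parsing the unary header *)

Lemma run_length_unary p j t : drop p s = unary j ++ t ->
  run_length s p = j /\ drop (p + j).+1 s = t.
Proof.
move=> eq_s; split.
  rewrite /run_length eq_s /unary -cats1 -catA find_cat has_nseq /= andbF.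
  by rewrite size_nseq addn0.
rewrite -addnS addnC -drop_drop eq_s drop_cat size_rcons size_nseq ltnn subnn.
exact: drop0.
Qed.

(** The number and its terminating [false] both lie inside the input, so neither [r] nor the cursor
    saturates. *)
Lemma den_Scan r j t m :
    r != cursor -> m r = 0 -> drop (m cursor) s = unary j ++ t ->
  let m' := den (Inc cursor) (den (Scan r) m) in
  [/\ m' r = j, drop (m' cursor) s = t & m' cursor <= N].
Proof.
move=> rh mr eq_s m'; have [l_eq dropE] := run_length_unary eq_s.
have := congr1 size eq_s.
rewrite size_drop size_cat /unary size_rcons size_nseq => sz.
have m'h : m' cursor = (m cursor + j).+1.
  by rewrite /m' /= !upd_eq l_eq; change ord0 with cursor; lia.
by rewrite m'h dropE; split=> //;
  [rewrite /m' /= 2?upd_neq // upd_eq l_eq mr|]; lia.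
Qed.

Lemma den_copy (r x : reg) m :
  m x = 0 -> m r <= N -> den (For r (Inc x)) m x = m r.
Proof.
by move=> mx le_r; rewrite den_for_inc mx // upd_eq add0n (minn_idPr _).
Qed.

Lemma den_Parse alts c num t :
    s = unary alts ++ unary c ++ unary num ++ t -> c < alts ->
  let m := den Parse (fun=> 0) in
  [/\ forall r, r \in [:: size1; size2; size_w; size_d; size_b] -> m r = alts,
      m votes = num, m cand = c, drop (m base) s = t &
      m alt_w = 0 /\ m found = 0].
Proof.
move=> sE lt_c m.
have le_alts : alts <= N.
  by rewrite sE size_cat /unary size_rcons size_nseq; lia.
rewrite /m /Parse 6!den_seq.
have [] := @den_Scan size1 alts (unary c ++ unary num ++ t) (fun=> 0) isT erefl.
  by rewrite drop0.
set m1 := den (Inc cursor) _ => m1s m1h _.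
have [|] := @den_Scan cand c (unary num ++ t) m1 isT _ m1h.
  by rewrite /m1 !den_frame.
set m2 := den (Inc cursor) _ => m2s m2h _.
have [|] := @den_Scan votes num t m2 isT _ m2h.
  by rewrite /m2 /m1 !den_frame.
set m3 := den (Inc cursor) _ => m3s m3h le_h.
have fr r : r \notin [:: cursor; size1; cand; votes] -> m3 r = 0.
  rewrite !inE !negb_or => /and4P[? ? ? ?].
  by rewrite /m3 /m2 /m1 !den_frame //= !inE ?negb_or; do ?(apply/andP; split).
have m3_alts : m3 size1 = alts by rewrite /m3 /m2 !den_frame.
have m3_cand : m3 cand = c by rewrite /m3 !den_frame.
rewrite 4!den_seq.
set m4 := den _ m3; set m5 := den _ m4; set m6 := den _ m5.
set m7 := den _ m6; set m8 := den _ m7.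
have fr8 r : r \notin [:: base; size2; size_w; size_d; size_b] -> m8 r = m3 r.
  rewrite !inE !negb_or => /and5P[? ? ? ? ?].
  by rewrite /m8 /m7 /m6 /m5 /m4 !den_frame //= inE.
have m8_base : m8 base = m3 cursor.
  rewrite /m8 /m7 /m6 /m5 4?den_frame //.
  by rewrite /m4 den_copy //; apply: fr.
have m8_size2 : m8 size2 = alts.
  rewrite /m8 /m7 /m6 3?den_frame // /m5.
  by rewrite den_copy /m4 ?den_frame ?m3_alts // fr.
have m8_size_w : m8 size_w = alts.
  rewrite /m8 /m7 2?den_frame // /m6.
  by rewrite den_copy /m5 /m4 ?den_frame ?m3_alts // fr.
have m8_size_d : m8 size_d = alts.
  rewrite /m8 den_frame // /m7.
  by rewrite den_copy /m6 /m5 /m4 ?den_frame ?m3_alts // fr.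
have m8_size_b : m8 size_b = alts.
  rewrite /m8.
  by rewrite den_copy /m7 /m6 /m5 /m4 ?den_frame ?m3_alts // fr.
have m8_size1 : m8 size1 = alts by rewrite fr8.
split; [|by rewrite fr8|by rewrite fr8|by rewrite m8_base
  |by rewrite !fr8 // !fr].
by move=> r; rewrite !inE; do 4!(case/predU1P => [->//|]); move/eqP ->.
Qed.

Lemma den_Main alts c num t (o : nat -> nat -> nat -> bool) :
    s = unary alts ++ unary c ++ unary num ++ t -> c < alts ->
    (forall i x y, i < num -> x < alts -> y < alts ->
       nth false t (i * (alts * alts) + x * alts + y) = o i x y) ->
  (den Main (fun=> 0) found == 0) =
    ~~ has (tie_found alts num c o) (iota 0 alts).
Proof.
move=> sE lt_c tE; rewrite /Main den_seq.
have [m_alts m_num m_c dropE [m_w m_f]] := den_Parse sE lt_c.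
set m := den Parse _ in m_alts m_num m_c dropE m_w m_f *.
(* The unary header makes [N] exceed the numbers of alternatives and of votes, so these fit into the
   counters. *)
have sz : N = alts.+1 + (c.+1 + (num.+1 + size t)).
  by rewrite sE !size_cat /unary !size_rcons !size_nseq.
apply: (@den_rivals m) => //; try lia.
by move=> i x y *; rewrite -!addnA -nth_drop dropE addnA tE.
Qed.

End Semantics.

(** Row-major addressing, used for the matrices within a profile and again for the rows within a
    matrix. *)
Lemma nth_flatten_const (T : Type) (x0 : T) (ss : seq (seq T)) l i j :
    all (fun s => size s == l) ss -> j < l -> i < size ss ->
  nth x0 (flatten ss) (i * l + j) = nth x0 (nth [::] ss i) j.
Proof.
move=> + lt_j; elim: ss i => //= s ss IHss i /andP[/eqP sz all_ss] lt_i.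
rewrite nth_cat sz; case: i lt_i => [|i] lt_i; first by rewrite add0n lt_j.
by rewrite mulSn -addnA ltnNge leq_addr /= addKn IHss.
Qed.

(** * From matrix entries back to partial orders *)

Section Encoding.
Variable I : poset_instance.
Notation C := (pi_alt I).

Definition matrices : seq bool :=
  flatten (map (@order_bits C) (pi_profile I)).

Definition entry (i x y : nat) : bool :=
  nth false matrices (i * (#|C| * #|C|) + x * #|C| + y).

Lemma entryE (i : 'I_(pi_size I)) (a b : C) :
  entry i (enum_rank a) (enum_rank b) = tnth (pi_profile I) i a b.
Proof.
have ra := ltn_ord (enum_rank a); have rb := ltn_ord (enum_rank b).
have szm : size (enum C) = #|C| by rewrite -cardE.
have all_sz : all (fun s => size s == #|C| * #|C|)
                  (map (@order_bits C) (pi_profile I)).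
  rewrite all_map (@eq_all _ _ predT) ?all_predT // => V.
  by rewrite /= size_allpairs szm eqxx.
have lt_ab : enum_rank a * #|C| + enum_rank b < #|C| * #|C|.
  by apply: leq_trans (leq_mul ra (leqnn _)); rewrite mulSn addnC ltn_add2r.
rewrite /entry -addnA nth_flatten_const ?size_map ?size_tuple //.
rewrite (nth_map (tnth (pi_profile I) i)) ?size_tuple // -tnth_nth.
rewrite /order_bits nth_flatten_const ?size_map ?szm //.
  by rewrite (nth_map a) ?szm // (nth_map a) ?szm // !nth_enum_rank.
rewrite all_map (@eq_all _ _ predT) ?all_predT // => x.
by rewrite /= size_map szm eqxx.
by rewrite -enumT szm.
Qed.

Local Notation c := (pi_cand I).
Local Notation tyingI := (tying #|C| (pi_size I) (enum_rank c) entry).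

Lemma tyingP (w d : C) :
  reflect (can_tie (pi_profile I) c w d) (tyingI (enum_rank w) (enum_rank d)).
Proof.
have neqE (a b : C) : (nat_of_ord (enum_rank a) == enum_rank b) = (a == b).
  by rewrite val_eqE (inj_eq enum_rank_inj).
have mustE : \sum_(i < pi_size I) must (enum_rank c) entry (enum_rank d) i =
             count (must_beat c d) (pi_profile I).
  by rewrite count_tuple; apply: eq_bigr => i _; rewrite /must entryE.
have canE b : \sum_(i < pi_size I) can (enum_rank c) entry (enum_rank w)
                  (enum_rank d) (enum_rank b) i =
              count (fun V => can_beat c w d V b) (pi_profile I).
  by rewrite count_tuple; apply: eq_bigr => i _; rewrite /can !entryE.
rewrite /tying !neqE; apply: (iffP and3P) => [] [wc dc beat]; split=> //.
  move=> b bw; have /(allP beat) : nat_of_ord (enum_rank b) \in iota 0 #|C|.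
    by rewrite mem_iota /= add0n.
  by rewrite /unbeaten neqE (negPf bw) mustE canE.
apply/allP => x; rewrite mem_iota add0n /= => lt_x.
have [b ->] : exists b : C, x = enum_rank b.
  by exists (enum_val (Ordinal lt_x)); rewrite enum_valK.
by rewrite /unbeaten neqE mustE canE; case: eqVneq => //= /beat.
Qed.

Lemma den_Main_encode :
  (den (encode_instance I) Main (fun=> 0) found == 0) <->
  necessary_winner (@maximin C) (pi_profile I) c.
Proof.
rewrite (@den_Main _ #|C| (enum_rank c) (pi_size I) matrices entry) //.
apply: iff_trans (iff_sym (necessary_winnerP _ _)).
have rankP x : x \in iota 0 #|C| -> exists a : C, x = enum_rank a.
  rewrite mem_iota add0n /= => lt_x.
  by exists (enum_val (Ordinal lt_x)); rewrite enum_valK.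
have rank_in (a : C) : nat_of_ord (enum_rank a) \in iota 0 #|C|.
  by rewrite mem_iota add0n /=.
split=> [/hasPn no_tie [w [d /tyingP tie]]|no_tie].
  by have /hasPn/(_ _ (rank_in d))/negP := no_tie _ (rank_in w).
apply/hasPn => x /rankP[w ->]; apply/hasPn => y /rankP[d ->].
by apply/negP => /tyingP tie; apply: no_tie; exists w, d.
Qed.

End Encoding.

Theorem proposition4 :
  polytime_decidable encode_instance
    (fun I : poset_instance =>
       necessary_winner (@maximin (pi_alt I)) (pi_profile I) (pi_cand I)).
Proof.
have [p pP] := program_polytime found wf_Main.
exists (program_machine Main found), p => I.
have [halts accE] := pP (encode_instance I); split; first exact: halts.
by apply: iff_trans (den_Main_encode I); rewrite -accE.
Qed.
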